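(* Let $k\ge2$ be an integer and let $x_0$ be a rational number with $x_0\neq0,\pm1,\pm2$. Consider the orbit $x_{n+1}=C_k(x_n)$, $n\ge0$. Then the set of primes which divide the numerator of $x_n$ for some $n\ge0$ has prime density zero.
   Context: Chebyshev polynomials of the first kind: $C_0(x)=2$, $C_1(x)=x$, $C_{n+1}(x)=xC_n(x)-C_{n-1}(x)$. Numerators are taken with the rational numbers written in lowest terms. Prime density of a set $A$ of primes: $\lim_{x\to\infty}\#\{p\in A: p\le x\}/\#\{p \text{ prime}: p\le x\}$. *)

(* Defs.v *)
From mathcomp Require Import all_boot all_order all_algebra.
From mathcomp Require Import all_classical all_reals all_analysis.

Set Implicit Arguments.
Unset Strict Implicit.
Unset Printing Implicit Defensive.

Import Order.TTheory GRing.Theory Num.Theory.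
Import numFieldNormedType.Exports.

Local Open Scope classical_set_scope.
Local Open Scope ring_scope.

(* Normalised so that C_n (y + 1/y) = y ^ n + 1 / y ^ n; in terms of the usual
   T_n this is C_n (x) = 2 * T_n (x / 2). *)
Fixpoint chebC (n : nat) : {poly rat} :=
  match n with
  | 0%N => 2%:P
  | 1%N => 'X
  | (m.+1 as n').+1 => 'X * chebC n' - chebC m
  end.

(* For 0 <= x the bound p <= Num.truncn x is the bound p%:R <= x; for x < 0
   the truncation is 0 and the count is 0. *)
Definition prime_count (R : realType) (A : set nat) (x : R) : nat :=
  count (fun p => prime p && (p \in A)) (iota 0 (Num.truncn x).+1).

(* The quotient is 0 / 0 = 0 for x < 2, which does not affect the limit. *)
Definition has_prime_density (R : realType) (A : set nat) (d : R) : Prop :=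
  (prime_count A (x : R))%:R / (prime_count [set: nat] x)%:R @[x --> +oo] --> d.

Definition numerator_primes (x : nat -> rat) : set nat :=
  [set p | prime p /\ exists n, (p%:Z %| numq (x n))%Z].

(* Main.v *)
Require Import Defs.
From mathcomp Require Import all_boot all_order all_algebra.
From mathcomp Require Import all_classical all_reals all_analysis.
From mathcomp Require Import closed_field ring zify.

Set Implicit Arguments.
Unset Strict Implicit.
Unset Printing Implicit Defensive.

Import Order.TTheory GRing.Theory Num.Theory.
Import numFieldNormedType.Exports.

Local Open Scope classical_set_scope.
Local Open Scope ring_scope.

(** Write x_0 = a / b in lowest terms, and let alpha, beta be the roots of
    T^2 - a T + b^2.  As C_m (C_n (x)) = C_{mn} (x), the iterate x_n equals
    U_n / b^(k^n) with U_n = alpha^(k^n) + beta^(k^n), an integer which is a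
    term of a Lucas sequence ([chebC_orbit], [numerator_dvd_lucasV]).  So every
    prime dividing a numerator divides some U_n, and none of the U_n is zero
    ([lucasV_neq0]; this is where the excluded values of x_0 matter).

    Let p be a prime not dividing 2 b, let n be the first index with p | U_n,
    and suppose n >= 1.  In characteristic p the quotient z = alpha / beta satisfies
    z^(k^n) = -1, so that its order divides 2 k^n, but it does not divide
    2 k^(n-1): otherwise z^(k^(n-1)) = -1, against the choice of n, or
    z^(k^(n-1)) = 1, whence z^(k^n) = 1.  Some prime l | k therefore occurs in
    the order of z with multiplicity at least n.  Frobenius fixes or swaps alpha
    and beta, so z^(p-1) = 1 or z^(p+1) = 1, and l^n divides p - 1 or p + 1
    ([prime_power_dvd_pm1]).

    Fix a threshold N >= 1 and count the primes p <= M of this kind, leaving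
    out the finitely many divisors of 2 b.  Those with n < N divide
    one of U_0, ..., U_(N-1), which have O(k^N) bits in total, so there are
    O(k^N) of them.  Those with n >= N satisfy p = 1 or -1 modulo l^N for one
    of the finitely many primes l | k, so there are O(M / 2^N) of them
    ([orbit_count_le]).  When k^(2N) <= M < k^(2N+2) both bounds are
    O(M / 2^N), while Chebyshev's lower bound gives at least a constant times
    M / N primes up to M ([prime_count_lower]); the quotient is O(N / 2^N). *)

(** * Counting in an initial segment of the integers *)

Lemma count_has_le (I T : Type) (P : I -> pred T) (ls : seq I) (s : seq T) :
  (count (fun x => has (fun l => P l x) ls) s <= \sum_(l <- ls) count (P l) s)%N.
Proof.
elim: ls => [|l ls IH]; first by rewrite big_nil /= count_pred0.
rewrite big_cons; apply: leq_trans (leq_add (leqnn _) IH).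
rewrite -count_predUI; exact: leq_addr.
Qed.

Lemma count_mem_le_size (T : eqType) (s r : seq T) :
  uniq r -> (count (mem s) r <= size s)%N.
Proof.
move=> Ur; rewrite -size_filter; apply: uniq_leq_size (filter_uniq _ Ur) _.
by move=> x; rewrite mem_filter => /andP[].
Qed.

Lemma count_dvdn_succ q m :
  (0 < q)%N -> count (fun i => q %| i.+1)%N (iota 0 m) = (m %/ q)%N.
Proof.
move=> q0; elim: m => [|m IH]; first by rewrite div0n.
by rewrite -addn1 iotaD count_cat IH addn1 divnS //= addn0 addnC.
Qed.

Lemma count_dvdn_pred q m :
  (0 < q)%N ->
  count (fun i => (1 < i) && (q %| i.-1))%N (iota 0 m.+2) = (m %/ q)%N.
Proof.
move=> q0; elim: m => [|m IH]; first by rewrite div0n.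
by rewrite -[m.+3]addn1 iotaD count_cat IH divnS //= addn0 addnC.
Qed.

Lemma expn_size_le_prod (s : seq nat) c (F : nat -> nat) :
  (forall p, p \in s -> c <= F p)%N -> (c ^ size s <= \prod_(p <- s) F p)%N.
Proof.
elim: s => [|p s IH] h; first by rewrite big_nil.
rewrite big_cons /= expnS leq_mul ?h ?mem_head //.
by apply: IH => q qs; apply: h; rewrite inE qs orbT.
Qed.

Lemma prod_le_expn_size (s : seq nat) c (F : nat -> nat) :
  (forall p, p \in s -> F p <= c)%N -> (\prod_(p <- s) F p <= c ^ size s)%N.
Proof.
elim: s => [|p s IH] h; first by rewrite big_nil.
rewrite big_cons /= expnS leq_mul ?h ?mem_head //.
by apply: IH => q qs; apply: h; rewrite inE qs orbT.
Qed.

Lemma prod_primes_logn n :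
  (0 < n)%N -> (\prod_(p <- primes n) p ^ logn p n)%N = n.
Proof.
by move=> n0; rewrite [RHS]prod_prime_decomp // prime_decompE big_map.
Qed.

(** Each of the distinct prime divisors of n contributes a factor at least 2
    to its factorization. *)
Lemma exp2_size_primes_le n : (0 < n)%N -> (2 ^ size (primes n) <= n)%N.
Proof.
move=> n0; rewrite -[leqRHS]prod_primes_logn //.
apply: expn_size_le_prod => p pn.
have := pn; rewrite mem_primes => /and3P[pp _ _].
rewrite -logn_gt0 in pn.
apply: leq_trans (prime_gt1 pp) _.
by rewrite -{1}[p]expn1 leq_exp2l // prime_gt1.
Qed.

(** * Chebyshev's lower bound for the number of primes *)

Lemma logn_fact_wide p n N : prime p -> (n <= N)%N ->
  logn p n`! = (\sum_(1 <= j < N.+1) n %/ p ^ j)%N.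
Proof.
move=> pp nN; rewrite logn_fact // [RHS](@big_cat_nat _ _ _ n.+1) //=.
rewrite [X in _ = (_ + X)%N]big_nat_cond [X in _ = (_ + X)%N]big1 ?addn0 // => j.
rewrite andbT => /andP[nj _]; apply: divn_small.
by apply: leq_trans nj _; apply: ltnW; apply: ltn_expl; apply: prime_gt1.
Qed.

Lemma sum_leq_bool_le L n : (\sum_(1 <= j < n.+1) (j <= L)%N <= L)%N.
Proof.
suff -> : (\sum_(1 <= j < n.+1) (j <= L)%N = minn n L)%N by apply: geq_minr.
elim: n => [|n IH]; first by rewrite big_geq // min0n.
by rewrite big_nat_recr //= IH; lia.
Qed.

(** By Legendre's formula the valuation of the central binomial coefficient is
    the sum over j of floor (2m / p^j) - 2 floor (m / p^j); each term is at most
    1 and vanishes once p^j > 2m, so the valuation is at most log_p (2m). *)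
Lemma pfactor_central_bin p m : prime p -> (0 < m)%N ->
  (p ^ logn p 'C(m.*2, m) <= m.*2)%N.
Proof.
move=> pp m0; have p1 := prime_gt1 pp.
have m20 : (0 < m.*2)%N by rewrite double_gt0.
apply: leq_trans (trunc_logP p1 m20); rewrite leq_exp2l //.
set L := trunc_log p m.*2.
have mm : (m <= m.*2)%N by rewrite -addnn leq_addr.
have := congr1 (logn p) (bin_fact mm).
have -> : (m.*2 - m = m)%N by rewrite -addnn addnK.
rewrite !lognM ?muln_gt0 ?fact_gt0 ?bin_gt0 //.
rewrite !(@logn_fact_wide _ _ m.*2) //= -big_split /= => eqC.
suff : (\sum_(1 <= j < m.*2.+1) m.*2 %/ p ^ j <=
   L + \sum_(1 <= j < m.*2.+1) (m %/ p ^ j + m %/ p ^ j))%N.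
  by rewrite -eqC leq_add2r.
apply: leq_trans (leq_add (sum_leq_bool_le L m.*2) (leqnn _)).
rewrite -big_split /=; apply: leq_sum => j _.
have q0 : (0 < p ^ j)%N by rewrite expn_gt0 ltnW.
case: (leqP (p ^ j) m.*2) => hj.
  have -> : (j <= L)%N by apply: trunc_log_max.
  rewrite -ltnS ltn_divLR //.
  have := divn_eq m (p ^ j); have := ltn_pmod m q0.
  set q := (p ^ j)%N; set A := (m %/ q)%N; set B := (m %% q)%N => h1 h2.
  by rewrite [in X in (X < _)%N]h2; lia.
by rewrite divn_small.
Qed.

Lemma exp2_le_central_bin m : (2 ^ m <= 'C(m.*2, m))%N.
Proof.
elim: m => [|m IH]; first by rewrite bin0.
rewrite doubleS !binS expnS mul2n -addnn.
case: m IH => [|m] IH; first by [].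
rewrite !binS in IH *; lia.
Qed.

(** The central binomial coefficient is at least 2^m, and it is a product of
    prime powers, each at most 2m, over distinct primes at most 2m. *)
Lemma exp2_le_expn_count_prime m : (0 < m)%N ->
  (2 ^ m <= m.*2 ^ count prime (iota 0 m.*2.+1))%N.
Proof.
move=> m0; apply: leq_trans (exp2_le_central_bin m) _.
have m20 : (0 < m.*2)%N by rewrite double_gt0.
have C0 : (0 < 'C(m.*2, m))%N by rewrite bin_gt0 -addnn leq_addr.
rewrite -[leqLHS]prod_primes_logn //.
apply: (@leq_trans (m.*2 ^ size (primes 'C(m.*2, m)))%N).
  apply: prod_le_expn_size => p; rewrite mem_primes => /and3P[pp _ _].
  exact: pfactor_central_bin.
rewrite leq_pexp2l // -size_filter.
apply: uniq_leq_size (primes_uniq _) _ => p pC.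
have := pC; rewrite mem_primes => /and3P[pp _ pd].
rewrite mem_filter pp mem_iota /= add0n ltnS.
apply: leq_trans (pfactor_central_bin pp m0).
by rewrite -{1}[p]expn1 leq_exp2l ?prime_gt1 // logn_gt0.
Qed.

(** * Valuations of orders *)

(** Some prime l has a larger valuation in d than in c k^n; since d divides
    c k^(n+1), passing from k^n to k^(n+1) must increase that valuation, so
    l | k, and the valuation of d exceeds n times that of k, which is at
    least n. *)
Lemma prime_pow_dvd_of_ndvd d c k n : (0 < c)%N -> (0 < k)%N ->
  (d %| c * k ^ n.+1)%N -> ~~ (d %| c * k ^ n)%N ->
  exists l, [/\ prime l, (l %| k)%N & (l ^ n.+1 %| d)%N].
Proof.
move=> c0 k0 d1 d2.
have P0 i : (0 < c * k ^ i)%N by rewrite muln_gt0 c0 expn_gt0 k0.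
have d0 : (0 < d)%N by apply: dvdn_gt0 d1.
have [l lp hl] : exists2 l, prime l & (logn l (c * k ^ n) < logn l d)%N.
  apply: contrapT => H; move/negP: d2; apply.
  apply/(dvdn_partP _ d0) => p; rewrite mem_primes => /and3P[pp _ _].
  rewrite p_part pfactor_dvdn // leqNgt; apply/negP => lt.
  by apply: H; exists p.
have lk i : (logn l (c * k ^ i) = logn l c + i * logn l k)%N.
  by rewrite lognM ?expn_gt0 ?k0 // lognX.
have := dvdn_leq_log l (P0 _) d1; move: hl; rewrite !lk => h1 h2.
have v0 : (0 < logn l k)%N by nia.
exists l; split => //; first by move: v0; rewrite logn_gt0 mem_primes => /and3P[].
by rewrite pfactor_dvdn //; nia.
Qed.

(** * Lucas sequences and the numerators of the orbit *)

(** The Lucas sequence V_n (P, Q), with P and Q the sum and the product of the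
    roots; over a ring it makes sense without those roots, and it specializes
    both to C_n (x) = V_n (x, 1) and to the homogenized integers
    V_n (a, b^2) = b^n C_n (a / b). *)
Fixpoint lucasV (R : pzRingType) (P Q : R) (n : nat) : R :=
  match n with
  | 0%N => 2
  | 1%N => P
  | (m.+1 as n').+1 => P * lucasV P Q n' - Q * lucasV P Q m
  end.

Lemma lucasVSS (R : pzRingType) (P Q : R) n :
  lucasV P Q n.+2 = P * lucasV P Q n.+1 - Q * lucasV P Q n.
Proof. by []. Qed.

Lemma nat_ind2 (T : nat -> Prop) : T 0%N -> T 1%N ->
  (forall n, T n -> T n.+1 -> T n.+2) -> forall n, T n.
Proof.
move=> T0 T1 TS n; suff [] : T n /\ T n.+1 by [].
by elim: n => [|n [h1 h2]]; split=> //; apply: TS.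
Qed.

Lemma chebC_lucasV (r : rat) n : (chebC n).[r] = lucasV r 1 n.
Proof.
elim/nat_ind2: n => [||n IH1 IH2]; rewrite ?hornerC ?hornerX //.
by rewrite lucasVSS -IH1 -IH2 mul1r !hornerE.
Qed.

Lemma rmorph_lucasV (R S : pzRingType) (f : {rmorphism R -> S}) (P Q : R) n :
  f (lucasV P Q n) = lucasV (f P) (f Q) n.
Proof.
elim/nat_ind2: n => [||n IH1 IH2] //; first by rewrite /= rmorph_nat.
by rewrite !lucasVSS rmorphB !rmorphM IH1 IH2.
Qed.

Lemma lucasV_scale (R : comPzRingType) (c P Q : R) n :
  lucasV (c * P) (c ^+ 2 * Q) n = c ^+ n * lucasV P Q n.
Proof.
elim/nat_ind2: n => [||n IH1 IH2]; rewrite ?mul1r ?expr1 //.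
by rewrite !lucasVSS IH1 IH2 !exprS; ring.
Qed.

Lemma lucasV_roots (R : comPzRingType) (s t : R) n :
  lucasV (s + t) (s * t) n = s ^+ n + t ^+ n.
Proof.
elim/nat_ind2: n => [||n IH1 IH2]; rewrite ?expr1 //.
by rewrite lucasVSS IH1 IH2 !exprS; ring.
Qed.

(** In terms of the roots this is
    (s^n + t^n) (s^(a+n) + t^(a+n)) expanded, with Q = s t. *)
Lemma lucasV_add (R : comPzRingType) (P Q : R) a n :
  lucasV P Q (a + n + n)%N + Q ^+ n * lucasV P Q a =
  lucasV P Q n * lucasV P Q (a + n)%N.
Proof.
move: a; elim/nat_ind2: n => [a|a|n IH1 IH2 a]; first by rewrite !addn0 /=; ring.
  by rewrite !addn1 lucasVSS expr1 /=; ring.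
have := IH1 a.+2; have := IH2 a.+1.
rewrite !(addSn, addnS) => h2 h1.
rewrite (exprS Q n.+1) (lucasVSS P Q n) mulrBl -(mulrA P) -(mulrA Q (lucasV _ _ _)).
rewrite -h1 -h2 (exprS Q n) (lucasVSS P Q (a + n + n).+2) (lucasVSS P Q a).
by ring.
Qed.

(** The powers s^n and t^n of the roots have sum V_n (P, Q) and product Q^n.
    The proof uses the recurrence with step n instead of the roots, which need
    not exist in R. *)
Lemma lucasV_comp (R : comPzRingType) (P Q : R) n m :
  lucasV (lucasV P Q n) (Q ^+ n) m = lucasV P Q (m * n).
Proof.
elim/nat_ind2: m => [||m IH1 IH2]; rewrite ?mul1n //.
by rewrite lucasVSS IH1 IH2 !(mulSnr, addnA) -lucasV_add addrK.
Qed.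

Lemma chebC_orbit k (x : nat -> rat) :
  (forall n, x n.+1 = (chebC k).[x n]) ->
  forall n, x n = lucasV (x 0%N) 1 (k ^ n).
Proof.
move=> xS; elim=> [|n IH] //.
rewrite xS chebC_lucasV IH.
have := lucasV_comp (x 0%N) 1 (k ^ n) k; rewrite expr1n => ->.
by rewrite -expnS.
Qed.

(** The integer in the conclusion is denq r ^ n times the rational number in
    the hypothesis, and p is prime to the denominator of that number. *)
Lemma numerator_dvd_lucasV (r : rat) (p n : nat) :
  (p%:Z %| numq (lucasV r 1 n))%Z ->
  (p%:Z %| lucasV (numq r) (denq r ^+ 2) n)%Z.
Proof.
set U := lucasV (numq r) (denq r ^+ 2) n; set y := lucasV r 1 n.
have Uy : U%:~R = (denq r)%:~R ^+ n * y :> rat.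
  rewrite /y -lucasV_scale mulr1 /U (rmorph_lucasV (intmul 1)) rmorphXn /=.
  by rewrite numqE mulrC.
have eqU : (U * denq y = denq r ^+ n * numq y)%R.
  by apply: (@intr_inj rat); rewrite !rmorphM rmorphXn /= Uy numqE mulrA.
move=> pn.
have cop : coprimez p (denq y).
  by apply: coprimez_dvdl pn _; rewrite coprimezE coprime_num_den.
by rewrite -(Gauss_dvdzl _ cop) eqU dvdz_mull.
Qed.

Lemma lucasV_sub_pow (a b : int) n : (b %| lucasV a (b ^+ 2) n.+1 - a ^+ n.+1)%Z.
Proof.
elim: n => [|n IH]; first by rewrite expr1 subrr dvdz0.
rewrite lucasVSS [a ^+ n.+2]exprS.
have -> : a * lucasV a (b ^+ 2) n.+1 - b ^+ 2 * lucasV a (b ^+ 2) n - a * a ^+ n.+1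
  = a * (lucasV a (b ^+ 2) n.+1 - a ^+ n.+1) - b * (b * lucasV a (b ^+ 2) n) by ring.
by apply: rpredB; [exact: dvdz_mull | exact: dvdz_mulr].
Qed.

Lemma lucasV_grows (a : int) n : (3 <= `|a|)%N ->
  (2 <= `|lucasV a 1 n|)%N /\ (`|lucasV a 1 n| <= `|lucasV a 1 n.+1|)%N.
Proof.
move=> a3; elim: n => [|n [h1 h2]]; first by rewrite /=; lia.
split; first exact: leq_trans h2.
rewrite lucasVSS mul1r.
set u := lucasV a 1 n.+1 in h2 *; set v := lucasV a 1 n in h1 h2 *.
have : (`|(a * u)%R| = `|a| * `|u|)%N by rewrite abszM.
have : (3 * `|u| <= `|a| * `|u|)%N by rewrite leq_mul2r a3 orbT.
lia.
Qed.

(** If the term vanishes, then the denominator divides a power of the numerator,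
    so r is an integer; the excluded values leave |r| >= 3, where the absolute
    values of the sequence never decrease from their initial value 2. *)
Lemma lucasV_neq0 (r : rat) n :
  r <> 0 -> r <> 1 -> r <> -1 -> r <> 2 -> r <> -2 ->
  lucasV (numq r) (denq r ^+ 2) n != 0.
Proof.
move=> r0 r1 rN1 r2 rN2; apply/eqP => V0.
have b1 : denq r = 1.
  case: n V0 => [|n] // V0.
  have := lucasV_sub_pow (numq r) (denq r) n; rewrite V0 sub0r rpredN => d.
  have : coprimez (denq r) (numq r ^+ n.+1).
    by rewrite coprimezXr // coprimez_sym coprimezE coprime_num_den.
  rewrite coprimezE /coprime (gcdn_idPl d) => /eqP e.
  by have := denq_gt0 r; lia.
have ra : r = (numq r)%:~R by rewrite -{1}[r]divq_num_den b1 divr1.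
have a3 : (3 <= `|numq r|)%N.
  rewrite leqNgt; apply/negP => a2.
  have : numq r = 0 \/ numq r = 1 \/ numq r = -1 \/ numq r = 2 \/ numq r = -2 by lia.
  by case=> [|[|[|[|]]]] e; move: ra; rewrite e.
have := lucasV_grows n a3; rewrite b1 expr1n in V0; rewrite V0.
by case.
Qed.

Lemma lucasV_le (a b : int) n : b != 0 ->
  (`|lucasV a b n| <= 2 * (`|a| + `|b|) ^ n)%N.
Proof.
move=> b0; set H := (`|a| + `|b|)%N.
have H0 : (0 < H)%N by rewrite /H; lia.
elim/nat_ind2: n => [||n IH1 IH2]; rewrite ?expn0 ?expn1 //.
  by rewrite /= /H; lia.
rewrite lucasVSS.
have : (`|(a * lucasV a b n.+1 - b * lucasV a b n)%R| <=
   `|a| * `|lucasV a b n.+1| + `|b| * `|lucasV a b n|)%N.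
  by rewrite -!abszM; lia.
move=> /leq_trans; apply.
have HS : (H ^ n <= H ^ n.+1)%N by rewrite leq_pexp2l.
have -> : (2 * H ^ n.+2 = `|a| * (2 * H ^ n.+1) + `|b| * (2 * H ^ n.+1))%N.
  by rewrite -mulnDl -/H [in LHS]expnS; lia.
by apply: leq_add; rewrite leq_mul2l; apply/orP; right=> //; lia.
Qed.

(** * Orders modulo a prime *)

(** The order argument takes place in an algebraic closure of the field with p
    elements, where the roots s, t of T^2 - a T + b^2 live; z = s / t is defined
    because p does not divide b. *)
Lemma prime_power_dvd_pm1 (a b : int) (p k n : nat) :
  prime p -> p != 2%N -> ~~ (p%:Z %| b)%Z -> (0 < k)%N ->
  ~~ (p%:Z %| lucasV a (b ^+ 2) (k ^ n))%Z ->
  (p%:Z %| lucasV a (b ^+ 2) (k ^ n.+1))%Z ->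
  exists2 l, l \in primes k & (l ^ n.+1 %| p.-1)%N || (l ^ n.+1 %| p.+1)%N.
Proof.
move=> pp p2 pb k0.
have [K [f _]] := countable_algebraic_closure 'F_p.
have chK : p \in [pchar K] by rewrite (fmorph_pchar f) pchar_Fp.
rewrite !(dvdz_pcharf chK) in pb *.
rewrite !(rmorph_lucasV (intmul 1)) rmorphXn /=.
set A : K := a%:~R; set B : K := b%:~R in pb *.
have [s sE] := @GRing.solve_monicpoly K 2 (nth 0 [:: - B ^+ 2; A]) isT.
rewrite !big_ord_recl big_ord0 /= expr0 expr1 addr0 mulr1 in sE.
pose t := A - s.
have AE : A = s + t by rewrite /t; ring.
have BE : B ^+ 2 = s * t by rewrite /t mulrBr -expr2 sE; ring.
rewrite AE BE !lucasV_roots.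
have : s * t != 0 by rewrite -BE expf_neq0.
rewrite mulf_eq0 negb_or => /andP[s0 t0].
pose z := s / t.
have z0 : z != 0 by rewrite mulf_neq0 ?invr_eq0.
have zE m : (s ^+ m + t ^+ m == 0) = (z ^+ m == -1).
  have tm : t ^+ m != 0 by rewrite expf_neq0.
  by rewrite /z expr_div_n -[RHS]addr_eq0 -[RHS](inj_eq (mulIf tm)) mul0r mulrDl mul1r divfK.
rewrite !zE => zn /eqP zn1.
have two0 : (2%:R : K) != 0.
  by rewrite -(dvdn_pcharf chK) dvdn_prime2.
have intF (c : int) : (c%:~R : K) ^+ p = c%:~R.
  by rewrite -(pFrobenius_autE chK) rmorph_int.
have frob (u v : K) : (u - v) ^+ p = u ^+ p - v ^+ p.
  by rewrite -!(pFrobenius_autE chK) rmorphB.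
have tp : t ^+ p = A - s ^+ p by rewrite /t frob intF.
(* Frobenius fixes a and b, so s ^+ p is again a root of the quadratic. *)
have spE : (s ^+ p - s) * (s ^+ p - t) = 0.
  have sp2 : (s ^+ p) ^+ 2 = A * s ^+ p - B ^+ 2.
    rewrite -exprM mulnC exprM sE addrC frob exprMn intF.
    by rewrite -exprM mulnC exprM intF.
  rewrite BE AE in sp2.
  have -> : (s ^+ p - s) * (s ^+ p - t) = (s ^+ p) ^+ 2 - (s + t) * s ^+ p + s * t by ring.
  by rewrite sp2; ring.
have zpm : z ^+ p.-1 = 1 \/ z ^+ p.+1 = 1.
  move/eqP: spE; rewrite mulf_eq0 !subr_eq0 => /orP[/eqP sp|/eqP sp].
    left; apply: (mulfI z0).
    rewrite -exprS prednK ?prime_gt0 // mulr1 /z expr_div_n tp sp.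
    by rewrite AE addrAC subrr add0r.
  right; rewrite exprS /z expr_div_n tp sp AE addrK.
  by field; rewrite s0 t0.
have zz : z ^+ (2 * k ^ n.+1) = 1 by rewrite mulnC exprM zn1 sqrrN expr1n.
have kk0 : (0 < 2 * k ^ n.+1)%N by rewrite muln_gt0 expn_gt0 k0.
have [d dz dd] := prim_order_exists kk0 zz.
(* Otherwise z ^+ (k ^ n) would be -1, which zn forbids, or 1, and then zn1
   would give 1 = -1. *)
have nd : ~~ (d %| 2 * k ^ n)%N.
  rewrite (prim_order_dvd dz) mulnC exprM sqrf_eq1 (negPf zn) orbF.
  apply/eqP => z1; move: zn1; rewrite expnS mulnC exprM z1 expr1n => /eqP.
  by rewrite -subr_eq0 opprK (negPf two0).
have [l [lp lk ld]] := prime_pow_dvd_of_ndvd (isT : (0 < 2)%N) k0 dd nd.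
exists l; first by rewrite mem_primes lp k0 lk.
apply/orP; case: zpm => /eqP; rewrite -(prim_order_dvd dz) => h; [left|right];
  exact: dvdn_trans h.
Qed.

(** * Counting the primes attached to the orbit *)

(** For p not dividing 2 b, the cases are decided by the first index n with
    p | V_(k^n): either n < N, or l^n, and hence l^N, divides p - 1 or p + 1. *)
Lemma orbit_prime_cases (a b : int) (k N : nat) (p : nat) :
  (1 < k)%N -> (0 < N)%N -> (forall n, lucasV a (b ^+ 2) n != 0) -> b != 0 ->
  prime p -> (exists n, (p%:Z %| lucasV a (b ^+ 2) (k ^ n))%Z) ->
  p \in primes (2 * `|b|) ++
    flatten [seq primes `|lucasV a (b ^+ 2) (k ^ n)| | n <- iota 0 N] \/
  has (fun l => (1 < p) && ((l ^ N %| p.-1) || (l ^ N %| p.+1)))%N (primes k).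
Proof.
move=> k1 N0 V0 b0 pp [n0 hn0]; rewrite mem_cat.
have [pb|pb] := boolP (p \in primes (2 * `|b|)); first by left.
have exV : exists n, (p%:Z %| lucasV a (b ^+ 2) (k ^ n))%Z by exists n0.
case: (ex_minnP exV) => n hn hmin.
have [nN|Nn] := ltnP n N.
  left; apply/flattenP; exists (primes `|lucasV a (b ^+ 2) (k ^ n)|).
    by apply/mapP; exists n => //; rewrite mem_iota.
  by rewrite mem_primes pp absz_gt0 V0.
right; case: n Nn hn hmin => [|n] Nn hn hmin; first by lia.
move: pb; rewrite mem_primes pp muln_gt0 absz_gt0 b0 /= Euclid_dvdM // negb_or.
rewrite dvdn_prime2 // => /andP[p2 pb].
have nd : ~~ (p%:Z %| lucasV a (b ^+ 2) (k ^ n))%Z.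
  by apply/negP => /hmin; rewrite ltnn.
have [l lk ld] := prime_power_dvd_pm1 pp p2 pb (ltnW k1) nd hn.
apply/hasP; exists l => //; rewrite prime_gt1 //=.
have lN : (l ^ N %| l ^ n.+1)%N by apply: dvdn_exp2l.
by case/orP: ld => ld; apply/orP; [left|right]; apply: dvdn_trans ld.
Qed.

(** The n-th term is at most 2 H^(k^n) < 2^(1 + H k^n) with H = |a| + |b|, so it
    has at most 1 + H k^n prime divisors; by induction on N, using k >= 2, the sum over
    n < N is at most (1 + H) k^N. *)
Lemma size_flatten_primes_le (a b : int) k N : (1 < k)%N -> b != 0 ->
  (forall n, lucasV a b n != 0) ->
  (size (flatten [seq primes `|lucasV a b (k ^ n)| | n <- iota 0 N])
     <= (`|a| + `|b|).+1 * k ^ N)%N.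
Proof.
move=> k1 b0 V0; elim: N => [|N IH]; first by rewrite /=; lia.
rewrite -addn1 iotaD map_cat flatten_cat size_cat /= cats0 add0n.
set H := (`|a| + `|b|)%N in IH *.
have s1 : (size (primes `|lucasV a b (k ^ N)|) <= 1 + H * k ^ N)%N.
  rewrite -(leq_exp2l (m := 2)) //.
  apply: leq_trans (exp2_size_primes_le _) _; first by rewrite absz_gt0.
  apply: leq_trans (lucasV_le a _ b0) _; rewrite -/H expnD expn1 leq_mul2l /=.
  have [->|kN] := posnP (k ^ N); first by rewrite muln0.
  by rewrite expnM leq_exp2r // ltnW // ltn_expl.
apply: leq_trans (leq_add IH s1) _.
have k0 : (0 < k ^ N)%N by rewrite expn_gt0 ltnW.
by rewrite expnD expn1; nia.
Qed.

Lemma count_near_multiples_le q m : (0 < q)%N -> (0 < m)%N ->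
  (count (fun p => (1 < p) && ((q %| p.-1) || (q %| p.+1))) (iota 0 m.+1)
     <= m.-1 %/ q + m.+1 %/ q)%N.
Proof.
move=> q0; case: m => // m _; rewrite -[m.+1.-1]/m.
rewrite -(count_dvdn_pred m q0) -(count_dvdn_succ m.+2 q0) -count_predUI.
apply: leq_trans (leq_addr _ _); apply: sub_count => i /=.
by case/andP => -> /=.
Qed.

(** The factor 2^N clears the denominators l^N >= 2^N in the number of
    p <= M that are 1 or -1 modulo l^N. *)
Lemma orbit_count_le (a b : int) (k N M : nat) (P : pred nat) :
  (1 < k)%N -> (0 < N)%N -> (0 < M)%N ->
  (forall n, lucasV a (b ^+ 2) n != 0) -> b != 0 ->
  (forall p, P p -> prime p /\ exists n, (p%:Z %| lucasV a (b ^+ 2) (k ^ n))%Z) ->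
  (2 ^ N * count P (iota 0 M.+1) <=
     2 ^ N * (size (primes (2 * `|b|)) + (`|a| + `|b ^+ 2|).+1 * k ^ N)
     + size (primes k) * (2 * M))%N.
Proof.
move=> k1 N0 M0 V0 b0 PP.
pose s := primes (2 * `|b|) ++
    flatten [seq primes `|lucasV a (b ^+ 2) (k ^ n)| | n <- iota 0 N].
pose Q l p := ((1 < p) && ((l ^ N %| p.-1) || (l ^ N %| p.+1)))%N.
have sub : subpred P (predU (mem s) (fun p => has (Q^~ p) (primes k))).
  by move=> p /PP[pp ex]; apply/orP; apply: orbit_prime_cases.
have c1 : (count P (iota 0 M.+1) <=
   size s + \sum_(l <- primes k) count (Q l) (iota 0 M.+1))%N.
  apply: leq_trans (sub_count sub _) _.
  apply: (@leq_trans (count (mem s) (iota 0 M.+1) +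
     count (fun p => has (Q^~ p) (primes k)) (iota 0 M.+1))%N).
    by rewrite -count_predUI leq_addr.
  by apply: leq_add; [apply/count_mem_le_size/iota_uniq | apply: count_has_le].
have c2 : (2 ^ N * \sum_(l <- primes k) count (Q l) (iota 0 M.+1) <=
   size (primes k) * (2 * M))%N.
  rewrite big_distrr /= -sum1_size big_distrl /=.
  rewrite big_seq [leqRHS]big_seq; apply: leq_sum => l; rewrite mem_primes mul1n.
  case/and3P => lp _ _; have l0 : (0 < l ^ N)%N by rewrite expn_gt0 prime_gt0.
  apply: (@leq_trans (l ^ N * (M.-1 %/ l ^ N + M.+1 %/ l ^ N))%N).
    apply: leq_mul (count_near_multiples_le l0 M0).
    by rewrite leq_exp2r // prime_gt1.
  have := leq_divM M.-1 (l ^ N); have := leq_divM M.+1 (l ^ N).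
  rewrite mulnDr ![(l ^ N * _)%N]mulnC; lia.
have c3 : (size s <= size (primes (2 * `|b|)) + (`|a| + `|b ^+ 2|).+1 * k ^ N)%N.
  rewrite size_cat leq_add2l; apply: size_flatten_primes_le => //.
  by rewrite expf_neq0.
apply: leq_trans (leq_mul (leqnn _) c1) _.
by rewrite mulnDr; apply: leq_add c2; rewrite leq_mul2l c3 orbT.
Qed.

Lemma exp2_dominates_linear E N : (E.*2 <= N)%N -> (E * N.+1 <= 2 ^ N)%N.
Proof.
have base : (E * E.*2.+1 <= 2 ^ E.*2)%N.
  elim: E => [|[|E] IH] //; move: IH; rewrite !doubleS !expnS; nia.
elim: N => [|N IH].
  by rewrite leqn0 double_eq0 => /eqP->.
rewrite leq_eqVlt => /orP[/eqP <-//|]; rewrite ltnS => /IH h.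
rewrite expnS; nia.
Qed.

(** Chebyshev's bound in the form used here: log M is at most a constant
    times N + 1 when M < k^(2N+2). *)
Lemma prime_count_lower k N M : (1 < k)%N -> (1 < M)%N -> (M < k ^ (2 * N.+1))%N ->
  (M <= 6 * k * N.+1 * count prime (iota 0 M.+1))%N.
Proof.
move=> k1 M1 Mk; set c := count prime (iota 0 M.+1).
have m0 : (0 < M./2)%N by lia.
have mM : (M./2.*2 <= M)%N by lia.
have c1 : (count prime (iota 0 M./2.*2.+1) <= c)%N.
  rewrite /c -(subnKC (_ : M./2.*2.+1 <= M.+1)%N) ?ltnS //.
  by rewrite iotaD count_cat leq_addr.
have h : (2 ^ M./2 <= (2 ^ (k * (2 * N.+1))) ^ c)%N.
  apply: leq_trans (exp2_le_expn_count_prime m0) _.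
  apply: (@leq_trans (M ^ c)%N).
    apply: (@leq_trans (M ^ count prime (iota 0 M./2.*2.+1))%N).
      by case: (count _ _) => // j; rewrite leq_exp2r.
    by rewrite leq_exp2l.
  have [->|c0] := posnP c; first by rewrite !expn0.
  rewrite leq_exp2r //.
  apply: leq_trans (ltnW Mk) _; rewrite [leqRHS]expnM leq_exp2r //.
  by apply: ltnW; apply: ltn_expl.
move: h; rewrite -expnM leq_exp2l // => h.
have : (M <= 3 * M./2)%N by lia.
move=> /leq_trans; apply.
apply: (@leq_trans (3 * (k * (2 * N.+1) * c))%N); first by rewrite leq_mul2l.
by apply: eq_leq; ring.
Qed.

(** The choice N = floor (log_k M / 2) balances the two parts of the count: then
    2^N k^N <= k^(2N) <= M, so both are at most a constant times M / 2^N. *)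
Lemma orbit_primes_sparse (a b : int) (k : nat) (P : pred nat) :
  (1 < k)%N -> (forall n, lucasV a (b ^+ 2) n != 0) -> b != 0 ->
  (forall p, P p -> prime p /\ exists n, (p%:Z %| lucasV a (b ^+ 2) (k ^ n))%Z) ->
  forall e, exists M0, forall M, (M0 <= M)%N ->
    (e * count P (iota 0 M.+1) <= count prime (iota 0 M.+1))%N.
Proof.
move=> k1 V0 b0 PP e.
pose C := (size (primes (2 * `|b|)) + (`|a| + `|b ^+ 2|).+1 + 2 * size (primes k))%N.
pose E := (e * (C * (6 * k)))%N.
exists (k ^ (2 * E.*2.+1))%N => M hM.
have M1 : (1 < M)%N.
  apply: (leq_trans k1); apply: (leq_trans _ hM).
  by rewrite -{1}[k]expn1 leq_exp2l.
have M0 : (0 < M)%N by apply: ltnW.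
pose N := (trunc_log k M)./2.
have /andP[kT MT] := trunc_log_bounds k1 M0.
have hN : (E.*2.+1 <= N)%N.
  by have := trunc_log_max k1 hM; rewrite /N; lia.
have N0 : (0 < N)%N by apply: leq_trans hN.
have kN : (k ^ (2 * N) <= M)%N.
  by apply: leq_trans kT; rewrite leq_exp2l // /N; lia.
have Mk : (M < k ^ (2 * N.+1))%N.
  by apply: leq_trans MT _; rewrite leq_exp2l // /N; lia.
have h1 := orbit_count_le k1 N0 M0 V0 b0 PP.
have h2 := prime_count_lower k1 M1 Mk.
have kNM : (2 ^ N * k ^ N <= M)%N.
  by apply: leq_trans kN; rewrite mul2n -addnn expnD leq_mul2r leq_exp2r // k1 orbT.
have NM : (2 ^ N <= M)%N.
  by apply: leq_trans kNM; rewrite leq_pmulr // expn_gt0 ltnW.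
set c := count P _ in h1 *; set d := count prime _ in h2 *.
have h3 : (2 ^ N * c <= C * M)%N.
  apply: leq_trans h1 _; rewrite /C !mulnDl mulnDr.
  apply: leq_add; last by apply: eq_leq; ring.
  apply: leq_add; first by rewrite mulnC leq_mul2l NM orbT.
  by rewrite mulnCA leq_mul2l kNM orbT.
have h4 : (E * N.+1 <= 2 ^ N)%N by apply/exp2_dominates_linear/ltnW.
have P2 : (0 < 2 ^ N)%N by rewrite expn_gt0.
rewrite -(leq_pmul2l P2).
apply: (@leq_trans (E * N.+1 * d)%N); last by rewrite leq_mul2r h4 orbT.
have -> : (E * N.+1 * d = e * (C * (6 * k * N.+1 * d)))%N by rewrite /E; ring.
by rewrite mulnCA leq_mul2l; apply/orP; right; apply: leq_trans h3 _; rewrite leq_mul2l h2 orbT.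
Qed.

(** * Density zero *)

Lemma density0_of_sparse (R : realType) (A : set nat) :
  (forall e, exists M0, forall M, (M0 <= M)%N ->
    (e * count (fun p => prime p && (p \in A)) (iota 0 M.+1) <=
     count prime (iota 0 M.+1))%N) ->
  has_prime_density A (0 : R).
Proof.
move=> sparse; rewrite /has_prime_density.
apply/cvgrPdist_lt => eps eps0.
(* Any integer multiplier larger than 1 / eps makes the quotient smaller
   than eps. *)
have [M0 hM0] := sparse (Num.truncn eps^-1).+1.
near=> x.
have xM : (M0 <= Num.truncn x)%N.
  have x0 : 0 <= x by near: x; apply: nbhs_pinfty_ge; rewrite num_real.
  rewrite truncn_ge_nat //; near: x; apply: nbhs_pinfty_ge; rewrite num_real //.
have := hM0 _ xM; rewrite sub0r normrN /prime_count.
have -> : count (fun p => prime p && (p \in [set: nat])) (iota 0 (Num.truncn x).+1)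
   = count prime (iota 0 (Num.truncn x).+1).
  by apply: eq_count => p; rewrite in_setT andbT.
set c := count _ _; set d := count prime _ => cd.
rewrite ger0_norm ?divr_ge0 //.
have [->|d0] := posnP d; first by rewrite invr0 mulr0.
have dR : 0 < d%:R :> R by rewrite ltr0n.
rewrite ltr_pdivrMr // mulrC -ltr_pdivrMr //.
have [c0|c0] := posnP c; first by rewrite c0 mul0r.
apply: (@lt_le_trans _ _ (c%:R * (Num.truncn eps^-1).+1%:R)).
  rewrite ltr_pM2l ?ltr0n //; apply: truncnS_gt.
by rewrite mulrC -natrM ler_nat.
Unshelve. all: by end_near.
Qed.

Theorem mainTheorem13 (R : realType) (k : nat) (x : nat -> rat)
    (hk : (2 <= k)%N)
    (x0_neq0 : x 0%N <> 0)
    (x0_neq1 : x 0%N <> 1) (x0_neqN1 : x 0%N <> -1)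
    (x0_neq2 : x 0%N <> 2) (x0_neqN2 : x 0%N <> -2)
    (x_orbit : forall n : nat, x n.+1 = (chebC k).[x n]) :
  has_prime_density (numerator_primes x) (0 : R).
Proof.
apply/density0_of_sparse/(@orbit_primes_sparse (numq (x 0%N)) (denq (x 0%N)) k) => //.
- by move=> n; apply: lucasV_neq0.
move=> p /andP[pp]; rewrite inE => -[_ [n pn]]; split=> //; exists n.
by apply: numerator_dvd_lucasV; rewrite -chebC_orbit.
Qed.
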